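(* Let $C_1$ and $C_2$ be classical binary convolutional codes such that $C_i$ encodes $k_i$ information bits with $n$ bits per frame ($i=1,2$), and let $H_1(D)$ and $H_2(D)$ be respective check matrices corresponding to noncatastrophic, delay-free encoders, so that $H_i(D)$ has dimension $(n-k_i)\times n$. Let $c$ be the rank of the matrix $H_1(D)\,H_2^T(D^{-1})$. Then the entanglement-assisted quantum convolutional code resulting from $H_1(D)$ and $H_2(D)$, i.e. with quantum check matrix $$\left[\left.\begin{array}{c}H_1(D)\\0\end{array}\right|\begin{array}{c}0\\H_2(D)\end{array}\right],$$ encodes $k_1+k_2-n+c$ information qubits per frame, requires $c$ ebits per frame, and is an $[[n,\,k_1+k_2-n+c;\,c]]$ entanglement-assisted quantum convolutional code.
   Context: Classical check matrices. $H_i(D)$ is an $(n-k_i)\times n$ matrix over $\mathbb{F}_2[D]$. ''Corresponding to a noncatastrophic, delay-free encoder'' means that all invariant factors of $H_i(D)$ over $\mathbb{F}_2[D]$ are equal to $1$, i.e. $H_i(D)=A_i(D)\,[\,I\;\;0\,]\,B_i(D)$ with $A_i(D)$, $B_i(D)$ square matrices invertible over $\mathbb{F}_2[D]$ (products of elementary operations). Binary polynomial picture. A family of Pauli sequences on a stream of qubits divided into frames of $m$ qubits, taken up to phase and together with all frame shifts, is described by a matrix $[Z(D)\,|\,X(D)]$ with $m$ columns on each side, one row per generator. Entries are in $\mathbb{F}_2[D,D^{-1}]$ for finite-weight generators and in $\mathbb{F}_2(D)$ in general. Multiplication of a row by $D^l$ is a shift by $l$ frames. Two rows $(z_1|x_1)$,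 $(z_2|x_2)$ commute for all shifts iff the shifted symplectic product $z_1(D^{-1})\cdot x_2(D)+x_1(D^{-1})\cdot z_2(D)$ vanishes. A quantum check matrix is such a matrix whose rows need not commute. Row operations: interchange two rows, add a polynomial multiple of one row to another, multiply a row by a power of $D$, multiply a row by a nonzero polynomial (and inverses of these); two matrices are row equivalent if they differ by left multiplication by an invertible matrix over $\mathbb{F}_2(D)$. Finite-depth operations (column operations), used in every frame: CNOT from qubit $i$ to qubit $j\ne i$ delayed by $k\in\mathbb{Z}$ frames (in $X$: add $D^k\cdot$column $i$ to column $j$; in $Z$: add $D^{-k}\cdot$column $j$ to column $i$); Hadamard on qubit $i$ (swap column $i$ of $Z$ with column $i$ of $X$); SWAP of two qubits; delay/advance of qubit $i$ (multiply column $i$ of both $Z$ and $X$ by $D^l$, $l\in\mathbb{Z}$); and compositions. Infinite-depth operations: for a nonzero $f(D)\in\mathbb{F}_2[D,D^{-1}]$ and a qubit $i$, multiply column $i$ of $X$ by $1/f(D)$ and column $i$ of $Z$ by $f(D^{-1})$. Entanglement-assisted quantum convolutional codes. In each frame the receiver Bob holds $c$ qubits and the sender Alice holds $n$ qubits. The unencoded stream has per frame $c$ ebits (Bell states $(|00\rangle+|11\rangle)/\sqrt2$ between Bob's $c$ qubits and $c$ of Alice's), $n-k-c$ ancilla qubits in state $|0\rangle$ and $k$ information qubits, the latter two types held by Alice. Its stabilizer matrix has, for each ebit, a row with $Z$-entries $1$ on the two qubits of the ebit and a row with $X$-entries $1$ on these two qubits, and, for each ancilla, a row with single $Z$-entry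 $1$ on it (all other entries $0$). The information-qubit matrix has, for each information qubit, one row that is a single $Z$-entry $1$ and one row that is a single $X$-entry $1$ on that qubit. An encoding circuit is a finite sequence of finite-depth and infinite-depth operations on Alice's $n$ qubits; it acts on both matrices. It encodes the quantum check matrix $Q$ if the restriction of the resulting stabilizer matrix to Alice's columns is row equivalent to $Q$. A decoding circuit is a finite sequence of operations on all $n+c$ qubits (Bob holds them after transmission) after which the information-qubit matrix, modulo adding multiples of rows of the resulting stabilizer matrix, again consists of the operators $Z$ and $X$ (possibly shifted by powers of $D$) on $k$ individual qubits of each frame. An $[[n,k;c]]$ entanglement-assisted quantum convolutional code with quantum check matrix $Q$ is one with such an encoding and decoding circuit; it encodes $k$ information qubits per frame and requires (is encoded with) $c$ ebits per frame. The rank of a matrix is its rank over $\mathbb{F}_2(D)$. *)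

(* Defs.v *)
From HB Require Import structures.
From mathcomp Require Import all_boot all_order all_algebra.

Set Implicit Arguments.
Unset Strict Implicit.
Unset Printing Implicit Defensive.

Import GRing.Theory.
Local Open Scope ring_scope.

Notation F2D := {fraction {poly 'F_2}}.

Definition toF2D (p : {poly 'F_2}) : F2D := FracField.tofrac p.

Definition D : F2D := toF2D 'X.

(* p(D^-1) *)
Definition at_Dinv (p : {poly 'F_2}) : F2D :=
  (map_poly (fun a : 'F_2 => toF2D a%:P) p).[D^-1].

(* Classical codes: a rate k/n code is a k-dimensional subspace of F_2(D)^n. *)

Definition convolutional_code (n k : nat) (C : {vspace 'rV[F2D]_n}) : Prop :=
  \dim C = k.

Definition check_matrix (n m : nat) (C : {vspace 'rV[F2D]_n})
    (H : 'M[{poly 'F_2}]_(m, n)) : Prop :=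
  forall v : 'rV[F2D]_n, (v \in C) = (v *m (map_mx toF2D H)^T == 0).

(* All invariant factors over F_2[D] are 1: for m <= n, pid_mx m is [I 0], and
   unitmx is invertibility over the polynomial ring. *)
Definition noncatastrophic_delay_free (m n : nat)
    (H : 'M[{poly 'F_2}]_(m, n)) : Prop :=
  exists (A : 'M[{poly 'F_2}]_m) (B : 'M[{poly 'F_2}]_n),
    [/\ A \in unitmx, B \in unitmx & H = A *m pid_mx m *m B].

(* A family of r Pauli sequences on frames of N qubits is [Z(D) | X(D)]. *)
Notation pauli_mx r N := 'M[F2D]_(r, N + N).

Definition row_equivalent (r1 r2 m : nat)
    (A : 'M[F2D]_(r1, m)) (B : 'M[F2D]_(r2, m)) : Prop :=
  exists (e : r1 = r2) (T : 'M[F2D]_r2),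
    T \in unitmx /\ castmx (e, erefl m) A = T *m B.

(* [InfDepth i l p] is the infinite-depth operation on qubit i for the nonzero
   Laurent polynomial f(D) = D^l p(D). *)
Inductive op (N : nat) : Type :=
| CNOT (i j : 'I_N) (k : int) of i != j
| Hadamard (i : 'I_N)
| Swap (i j : 'I_N)
| Delay (i : 'I_N) (l : int)
| InfDepth (i : 'I_N) (l : int) (p : {poly 'F_2}) of p != 0.

Definition op_qubits (N : nat) (o : op N) : seq 'I_N :=
  match o with
  | CNOT i j _ _ => [:: i; j]
  | Hadamard i => [:: i]
  | Swap i j => [:: i; j]
  | Delay i _ => [:: i]
  | InfDepth i _ _ _ => [:: i]
  end.

Definition scale_col (r N : nat) (i : 'I_N) (x : F2D) (M : 'M[F2D]_(r, N)) :
    'M[F2D]_(r, N) :=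
  \matrix_(a, b) (if b == i then x * M a b else M a b).

Definition add_col (r N : nat) (i j : 'I_N) (x : F2D) (M : 'M[F2D]_(r, N)) :
    'M[F2D]_(r, N) :=
  \matrix_(a, b) (if b == j then M a b + x * M a i else M a b).

Definition replace_col (r N : nat) (i : 'I_N) (M' M : 'M[F2D]_(r, N)) :
    'M[F2D]_(r, N) :=
  \matrix_(a, b) (if b == i then M' a b else M a b).

Definition op_act (r N : nat) (o : op N) (M : pauli_mx r N) : pauli_mx r N :=
  let Z := lsubmx M in
  let X := rsubmx M in
  match o with
  | CNOT i j k _ => row_mx (add_col j i (D ^ (- k)) Z) (add_col i j (D ^ k) X)
  | Hadamard i => row_mx (replace_col i X Z) (replace_col i Z X)
  | Swap i j => row_mx (xcol i j Z) (xcol i j X)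
  | Delay i l => row_mx (scale_col i (D ^ l) Z) (scale_col i (D ^ l) X)
  | InfDepth i l p _ =>
      row_mx (scale_col i (D ^ (- l) * at_Dinv p) Z)
             (scale_col i (D ^ l * toF2D p)^-1 X)
  end.

Definition run (r N : nat) (w : seq (op N)) (M : pauli_mx r N) : pauli_mx r N :=
  foldl (fun M' o => op_act o M') M w.

(* Of the c + n qubits of a frame, 0, ..., c-1 are Bob's; the remaining n are
   Alice's, in the order: c ebit halves, n-k-c ancillas, k information qubits.
   These definitions are only meaningful when k + c <= n. *)

Definition ebit_mx (n c : nat) : 'M[F2D]_(c, c + n) :=
  \matrix_(i, j) ((j == i :> nat) || (j == c + i :> nat)%N)%:R.

Definition ancilla_mx (n k c : nat) : 'M[F2D]_(n - k - c, c + n) :=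
  \matrix_(i, j) (j == c + c + i :> nat)%N%:R.

Definition info_qubit_mx (n k c : nat) : 'M[F2D]_(k, c + n) :=
  \matrix_(i, j) (j == c + (n - k) + i :> nat)%N%:R.

Definition stabilizer_mx (n k c : nat) : pauli_mx (c + c + (n - k - c)) (c + n) :=
  col_mx (block_mx (ebit_mx n c) 0 0 (ebit_mx n c))
         (row_mx (ancilla_mx n k c) 0).

Definition info_mx (n k c : nat) : pauli_mx (k + k) (c + n) :=
  block_mx (info_qubit_mx n k c) 0 0 (info_qubit_mx n k c).

Definition alice_part (r c n : nat) (M : pauli_mx r (c + n)) : pauli_mx r n :=
  row_mx (rsubmx (lsubmx M)) (rsubmx (rsubmx M)).

Definition on_alice (c n : nat) (w : seq (op (c + n))) : bool :=
  all (fun o => all (fun q : 'I_(c + n) => (c <= q)%N) (op_qubits o)) w.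

Definition encodes (n k c r : nat) (enc : seq (op (c + n)))
    (Q : pauli_mx r n) : Prop :=
  on_alice enc /\
  row_equivalent (alice_part (run enc (stabilizer_mx n k c))) Q.

(* Information qubit i comes out on qubit s i, delayed by l i frames.  Its Z and
   X operators get the same delay: the operations preserve the shifted
   symplectic product, so distinct delays could not occur. *)
Definition decodes (n k c : nat) (enc dec : seq (op (c + n))) : Prop :=
  exists (s : 'I_k -> 'I_(c + n)) (l : 'I_k -> int)
         (W : 'M[F2D]_(k + k, c + c + (n - k - c))),
    let T := \matrix_(i < k, j < c + n) (if j == s i then D ^ l i else 0) in
    injective s /\
    run dec (run enc (info_mx n k c)) + W *m run dec (run enc (stabilizer_mx n k c))
    = block_mx T 0 0 T.

(* Q is the quantum check matrix of an [[n, k; c]] code. *)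
Definition EAQCC (n k c r : nat) (Q : pauli_mx r n) : Prop :=
  (k + c <= n)%N /\
  exists enc dec : seq (op (c + n)), encodes k enc Q /\ decodes k enc dec.

(* Main.v *)
(* Infinite-depth operations, together with Hadamards, multiply a column of X by
   any nonzero rational function, so finite- and infinite-depth operations
   generate every action X -> X M, Z -> Z M' with M in GL_n(F_2(D)) and M' the
   inverse conjugate transpose of M, conjugation being D -> 1/D.  It thus
   suffices to find a basis of F_2(D)^n (the rows of M) adapted to the row space
   V of H_2 and to the annihilator K of H_1: c vectors spanning a complement of
   V :&: K in V, a complement of V + K, a basis of V :&: K, and a complement of
   V :&: K in K.  Their dimensions are c, n - k_1 - c, n - k_2 - c and
   k_1 + k_2 - n + c.  The first three families are the images of the ebits, of
   the ancillas left in the Z basis and of the ancillas turned to the X basis; the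
   last one carries the information qubits.  Every operation has an inverse
   circuit, so decoding is running the inverse of the encoder. *)

Require Import Defs.
From HB Require Import structures.
From mathcomp Require Import all_boot all_order all_algebra zify ring.
Import GRing.Theory.
Set Implicit Arguments.
Unset Strict Implicit.
Unset Printing Implicit Defensive.
Local Open Scope ring_scope.

(** * The field F_2(D) and the substitution of 1/D for D *)

HB.instance Definition _ :=
  GRing.RMorphism.copy toF2D (@FracField.tofrac {poly 'F_2}).

Lemma toF2D_eq0 p : (toF2D p == 0) = (p == 0).
Proof. exact: tofrac_eq0. Qed.

Lemma toF2D_numden (x : F2D) :
  toF2D (frac (repr x)).1 / toF2D (frac (repr x)).2 = x.
Proof.
apply: (canLR (mulfK _)); first by rewrite toF2D_eq0 denom_ratioP.
rewrite -[X in _ = X * _]reprK /toF2D; unlock FracField.tofrac.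
rewrite -[RHS]FracField.pi_mul; apply/eqmodP.
rewrite /= FracField.equivfE /FracField.mulf.
by rewrite !numden_Ratio ?mulr1 ?mul1r ?oner_eq0 // ?denom_ratioP // mulrC.
Qed.

(** Named so that the coefficient map inside [at_Dinv] carries a ring morphism structure. *)
Definition constF (a : 'F_2) : F2D := toF2D a%:P.
HB.instance Definition _ := GRing.RMorphism.copy constF (toF2D \o polyC).

Lemma D_neq0 : D != 0.
Proof. by rewrite toF2D_eq0 polyX_eq0. Qed.

Lemma at_DinvE p : at_Dinv p = (map_poly constF p).[D^-1].
Proof. by []. Qed.

Lemma at_Dinv_is_zmod_morphism : zmod_morphism at_Dinv.
Proof. by move=> p q; rewrite !at_DinvE rmorphB hornerD hornerN. Qed.

Lemma at_Dinv_is_monoid_morphism : monoid_morphism at_Dinv.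
Proof.
by split=> [|p q]; rewrite !at_DinvE ?rmorph1 ?hornerC // rmorphM hornerM.
Qed.

HB.instance Definition _ :=
  GRing.isZmodMorphism.Build _ _ at_Dinv at_Dinv_is_zmod_morphism.
HB.instance Definition _ :=
  GRing.isMonoidMorphism.Build _ _ at_Dinv at_Dinv_is_monoid_morphism.

Lemma at_DinvX : at_Dinv 'X = D^-1.
Proof. by rewrite at_DinvE map_polyX hornerX. Qed.

Lemma at_DinvC a : at_Dinv a%:P = toF2D a%:P.
Proof. by rewrite at_DinvE map_polyC hornerC. Qed.

(** The reciprocal polynomial X^deg(p) p(1/X). It turns p(1/D) into a polynomial times a power of D,
    the shape that [InfDepth] accepts. *)
Definition reverse_poly (p : {poly 'F_2}) : {poly 'F_2} :=
  \poly_(i < size p) p`_((size p).-1 - i).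

Lemma at_Dinv_reverse p :
  at_Dinv p = toF2D (reverse_poly p) / D ^+ (size p).-1.
Proof.
apply: (canRL (mulfK _)); first by rewrite expf_neq0 ?D_neq0.
rewrite {1}(_ : p = \poly_(i < size p) p`_i); last by rewrite coefK.
rewrite /reverse_poly !poly_def !rmorph_sum mulr_suml /=.
rewrite [RHS](reindex_inj rev_ord_inj) /=; apply: eq_bigr => i _.
rewrite -!mul_polyC !(rmorphM at_Dinv, rmorphM toF2D) /= at_DinvC.
rewrite !rmorphXn /= at_DinvX -mulrA.
have subK m j : (j < m -> m.-1 - (m - j.+1) = j)%N by lia.
have addK m j : (j < m -> m.-1 = j + (m - j.+1))%N by lia.
rewrite subK //.
congr (_ * _).
by rewrite (addK _ _ (ltn_ord i)) exprD mulrA -exprMn mulVf ?D_neq0 // expr1n mul1r.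
Qed.

(** The constant coefficient of the reversal is the leading coefficient of [p]. *)
Lemma reverse_poly_neq0 p : p != 0 -> reverse_poly p != 0.
Proof.
move=> p0; apply/eqP => /polyP /(_ 0%N); rewrite coef_poly coef0 subn0.
by rewrite size_poly_gt0 p0 => /eqP; rewrite -lead_coefE lead_coef_eq0 (negPf p0).
Qed.

Lemma at_Dinv_eq0 p : (at_Dinv p == 0) = (p == 0).
Proof.
have [->|p0] := eqVneq p 0; first by rewrite rmorph0 eqxx.
rewrite at_Dinv_reverse mulf_eq0 invr_eq0 expf_eq0 (negPf D_neq0) andbF orbF.
by rewrite toF2D_eq0 (negPf (reverse_poly_neq0 p0)).
Qed.

(* The automorphism D -> 1/D of F_2(D). *)
Definition flip (x : F2D) : F2D :=
  at_Dinv (frac (repr x)).1 / at_Dinv (frac (repr x)).2.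

(** Independence of the representative: equality of fractions is a cross-multiplied polynomial
    identity, which the ring morphism [at_Dinv] preserves. *)
Lemma flip_fraction p q :
  q != 0 -> flip (toF2D p / toF2D q) = at_Dinv p / at_Dinv q.
Proof.
move=> q0; rewrite /flip; have d0 := denom_ratioP (repr (toF2D p / toF2D q)).
have := toF2D_numden (toF2D p / toF2D q).
move/eqP; rewrite eqr_div ?toF2D_eq0 // -!(rmorphM toF2D) /toF2D tofrac_eq => /eqP E.
by apply/eqP; rewrite eqr_div ?at_Dinv_eq0 // -!(rmorphM at_Dinv) E.
Qed.

Lemma flip_toF2D p : flip (toF2D p) = at_Dinv p.
Proof.
have := flip_fraction p (oner_neq0 {poly 'F_2}).
by rewrite !rmorph1 !divr1.
Qed.

Lemma F2D_fraction (x : F2D) :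
  exists p, exists2 q, q != 0 & x = toF2D p / toF2D q.
Proof.
exists (frac (repr x)).1; exists (frac (repr x)).2; first exact: denom_ratioP.
by rewrite toF2D_numden.
Qed.

Lemma flip_is_zmod_morphism : zmod_morphism flip.
Proof.
move=> x y; have [p [q q0 ->]] := F2D_fraction x.
have [p' [q' q'0 ->]] := F2D_fraction y.
have nz := (mulf_neq0 q0 q'0).
rewrite !flip_fraction // -!mulNr -(rmorphN toF2D) -(rmorphN at_Dinv).
rewrite !addf_div ?toF2D_eq0 ?at_Dinv_eq0 //.
rewrite -!(rmorphM toF2D) -(rmorphD toF2D) flip_fraction //.
rewrite (rmorphD at_Dinv) !(rmorphM at_Dinv).
by congr (_ / _).
Qed.

Lemma flip_is_monoid_morphism : monoid_morphism flip.
Proof.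
split=> [|x y]; first by rewrite -(rmorph1 toF2D) flip_toF2D !rmorph1.
have [p [q q0 ->]] := F2D_fraction x; have [p' [q' q'0 ->]] := F2D_fraction y.
rewrite mulf_div -!(rmorphM toF2D) !flip_fraction ?mulf_neq0 //.
by rewrite !rmorphM mulf_div.
Qed.

HB.instance Definition _ :=
  GRing.isZmodMorphism.Build _ _ flip flip_is_zmod_morphism.
HB.instance Definition _ :=
  GRing.isMonoidMorphism.Build _ _ flip flip_is_monoid_morphism.

Lemma flipD : flip D = D^-1.
Proof. by rewrite flip_toF2D at_DinvX. Qed.

Lemma flip_at_Dinv p : flip (at_Dinv p) = toF2D p.
Proof.
rewrite -[p]coefK !poly_def (rmorph_sum at_Dinv) (rmorph_sum flip).
rewrite (rmorph_sum toF2D); apply: eq_bigr => i _.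
rewrite -mul_polyC (rmorphM at_Dinv) (rmorphM toF2D) (rmorphM flip) /= at_DinvC.
rewrite flip_toF2D at_DinvC (rmorphXn at_Dinv) (rmorphXn flip) /= at_DinvX.
by rewrite fmorphV /= flipD invrK rmorphXn.
Qed.

Lemma flipK : involutive flip.
Proof.
move=> x; have [p [q q0 ->]] := F2D_fraction x.
by rewrite flip_fraction // fmorph_div /= !flip_at_Dinv.
Qed.

(** * Generation of the general linear group by elementary matrices *)

Section ElementaryGeneration.
Variables (F : fieldType) (n : nat).
Implicit Types (i j l : 'I_n) (u v : 'rV[F]_n).

(** Right multiplication by it adds x_j u to every row x. Transvections and scalings are the cases
    where [u] is a multiple of a unit vector. *)
Definition row_shear j u : 'M[F]_n := 1%:M + delta_mx j 0 *m u.

Lemma mulmx_row_shear m (X : 'M_(m, n)) j u :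
  X *m row_shear j u = X + col j X *m u.
Proof. by rewrite mulmxDr mulmx1 mulmxA -colE. Qed.

Lemma rV_row_shear u j v : u *m row_shear j v = u + u 0 j *: v.
Proof.
rewrite mulmx_row_shear (_ : col j u = (u 0 j)%:M) ?mul_scalar_mx //.
by apply/matrixP => a b; rewrite !ord1 !mxE.
Qed.

Lemma row_shearM j u v :
  row_shear j u *m row_shear j v = row_shear j (u + v + u 0 j *: v).
Proof.
rewrite {1}/row_shear mulmxDl mul1mx -mulmxA rV_row_shear /row_shear -addrA.
by rewrite -mulmxDr addrCA addrA.
Qed.

Lemma row_shear_delta j l x :
  row_shear j (x *: delta_mx 0 l) = 1%:M + x *: delta_mx j l.
Proof. by rewrite /row_shear -scalemxAr mul_delta_mx. Qed.

Variable P : 'M[F]_n -> Prop.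
Hypothesis P1 : P 1%:M.
Hypothesis PM : forall A B, P A -> P B -> P (A *m B).
Hypothesis P_transvection :
  forall i j x, i != j -> P (1%:M + x *: delta_mx i j).
Hypothesis P_scaling : forall i x, x != 0 -> P (1%:M + (x - 1) *: delta_mx i i).

(** With entry j of [u] removed, the shear is a product of transvections, whose vectors simply add.
    One scaling by [u 0 j + 1], nonzero by hypothesis, then restores entry j. *)
Lemma elementary_row_shear j u : u 0 j != -1 -> P (row_shear j u).
Proof.
move=> uj; pose K v := v 0 j = 0 /\ P (row_shear j v).
pose v : 'rV[F]_n := \sum_(b | b != j) u 0 b *: delta_mx 0 b.
have [vj Pv] : K v.
  apply: big_ind => [|v1 v2 [v1j Pv1] [v2j Pv2]|b bj].
  - by split; rewrite ?mxE // /row_shear mulmx0 addr0.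
  - split; first by rewrite mxE v1j v2j addr0.
    by have := PM Pv1 Pv2; rewrite row_shearM v1j scale0r addr0.
  - split; first by rewrite !mxE eq_sym (negPf bj) andbF mulr0.
    by rewrite row_shear_delta; apply: P_transvection; rewrite eq_sym.
have -> : u = v + u 0 j *: delta_mx 0 j.
  by rewrite {1}[u]row_sum_delta (bigD1 j) //= addrC.
have := PM Pv (@P_scaling j (u 0 j + 1) _).
rewrite addrK -row_shear_delta row_shearM vj scale0r addr0; apply.
by rewrite addr_eq0.
Qed.

(** Gaussian elimination by column operations: [t] bounds the number of rows not yet known to be
    unit vectors, and each round turns the first of them into one. *)
Lemma unitmx_elementary A : A \in unitmx -> P A.
Proof.
suff H t : forall B, B \in unitmx ->
    (forall i, (i < n - t)%N -> row i B = delta_mx 0 i) -> P B.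
  by move=> uA; apply: (H n) => // i; rewrite subnn.
elim: t => [|t IH] B uB rB.
  suff -> : B = 1%:M by [].
  by apply/row_matrixP => i; rewrite rB ?subn0 // row1.
have [tn|nt] := ltnP t n; last by apply: IH => // i; rewrite (eqP nt).
have jP : (n - t.+1 < n)%N by lia.
pose j := Ordinal jP.
have {}rB i : (i < j)%N -> row i B = delta_mx 0 i by apply: rB.
have leqj i : (i < n - t)%N -> (i < j)%N \/ i = j.
  move=> it; have [|ji] := ltnP i j; [by left | right].
  by apply: val_inj; move: ji => /=; lia.
(* A zero pivot is repaired by adding to column j a later column with a nonzero entry in row j. *)
wlog Bjj : B uB rB / B j j != 0 => [hw|].
  have [B0|] := eqVneq (B j j) 0; last exact: hw.
  have [l jl Bjl] : exists2 l : 'I_n, (j < l)%N & B j l != 0.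
    (* Otherwise row j would be supported where the rows of [B] are unit vectors, so [B] would fix
       it and kill the nonzero vector [delta_mx 0 j - row j B]. *)
    apply/exists_inP; apply: contraT => /exists_inPn Bj.
    have supp : row j B *m B = row j B.
      rewrite mulmx_sum_row [RHS]row_sum_delta; apply: eq_bigr => i _.
      have [/rB -> //|] := ltnP i j; rewrite leq_eqVlt mxE => /orP[/eqP ji|ji].
        by rewrite (_ : i = j) ?B0 ?scale0r //; apply: val_inj.
      by have /negPn/eqP -> := Bj i ji; rewrite !scale0r.
    have : (delta_mx 0 j - row j B) *m B = 0.
      by rewrite mulmxBl supp -rowE subrr.
    move/(congr1 (mulmx^~ (invmx B))); rewrite mulmxK // mul0mx.
    move/matrixP/(_ 0 j); rewrite !mxE !eqxx B0 subr0 => /eqP.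
    by rewrite oner_eq0.
  have lj : l != j by rewrite neq_ltn jl orbT.
  have shearK : row_shear l (delta_mx 0 j) *m row_shear l (- delta_mx 0 j)
      = 1%:M.
    rewrite row_shearM mxE eqxx /= eq_sym in lj *.
    by rewrite (negPf lj) scale0r addr0 subrr /row_shear mulmx0 addr0.
  have -> : B = B *m row_shear l (delta_mx 0 j) *m row_shear l (- delta_mx 0 j).
    by rewrite -mulmxA shearK mulmx1.
  apply: PM; last first.
    rewrite -scaleN1r row_shear_delta; exact: P_transvection.
  apply: hw => [|i ij|].
  - by rewrite unitmx_mul uB; case/mulmx1_unit: shearK.
  - rewrite row_mul rB // rV_row_shear mxE eqxx /=.
    by rewrite -val_eqE /= gtn_eqF ?scale0r ?addr0 // (ltn_trans ij).
  - by rewrite mulmx_row_shear mxE B0 add0r mxE big_ord1 !mxE !eqxx mulr1.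
pose u := row j B - delta_mx 0 j.
have uj1 : 1 + u 0 j = B j j by rewrite !mxE !eqxx /=; ring.
(* Multiplying by [row_shear j v] turns row j into a unit vector; [row_shear j u] undoes this, and
   it is elementary because the pivot [1 + u 0 j] is nonzero. *)
pose v := - (B j j)^-1 *: u.
have vu : row_shear j v *m row_shear j u = 1%:M.
  rewrite row_shearM (_ : v + u + _ = 0) /row_shear ?mulmx0 ?addr0 //.
  have {uj1} : u 0 j = B j j - 1 by rewrite -uj1 addrC addKr.
  rewrite {}/v; clearbody u => uj.
  by apply/rowP => b; rewrite !mxE uj; field.
have -> : B = B *m row_shear j v *m row_shear j u by rewrite -mulmxA vu mulmx1.
apply: PM; last first.
  apply: elementary_row_shear; apply: contra_neq Bjj => uj.
  by rewrite -uj1 uj subrr.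
apply: IH => [|i /leqj[ij|->]].
- by rewrite unitmx_mul uB; case/mulmx1_unit: vu.
- rewrite row_mul rB // rV_row_shear mxE eqxx /=.
  by rewrite -val_eqE /= gtn_eqF ?scale0r ?addr0.
- rewrite row_mul rV_row_shear mxE scalerA mulrN divff // scaleN1r.
  by rewrite opprB addrC subrK.
Qed.
End ElementaryGeneration.

(** * Circuits: their inverses and the column actions they realize *)

Lemma addFF (x : F2D) : x + x = 0.
Proof.
rewrite -[x]mulr1 -mulrDr -[1]/(toF2D 1%:P) -(rmorphD toF2D) -polyCD.
by rewrite (_ : 1 + 1 = 0) ?rmorph0 ?mulr0 //; apply/val_inj.
Qed.

Local Arguments op_act : simpl never.

Section Operations.
Variable N : nat.
Implicit Types (i j : 'I_N) (w : seq (op N)).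

Lemma run_cat r w1 w2 (M : pauli_mx r N) :
  run (w1 ++ w2) M = run w2 (run w1 M).
Proof. exact: foldl_cat. Qed.

Lemma op_act_row_mx r (o : op N) (Z X : 'M_(r, N)) :
  op_act o (row_mx Z X) = 
  match o with
  | CNOT i j k _ => row_mx (add_col j i (D ^ (- k)) Z) (add_col i j (D ^ k) X)
  | Hadamard i => row_mx (replace_col i X Z) (replace_col i Z X)
  | Swap i j => row_mx (xcol i j Z) (xcol i j X)
  | Delay i l => row_mx (scale_col i (D ^ l) Z) (scale_col i (D ^ l) X)
  | InfDepth i l p _ =>
      row_mx (scale_col i (D ^ (- l) * at_Dinv p) Z)
             (scale_col i (D ^ l * toF2D p)^-1 X)
  end.
Proof. by rewrite /op_act row_mxKl row_mxKr. Qed.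

Lemma scale_colM r i x y (M : 'M_(r, N)) :
  scale_col i x (scale_col i y M) = scale_col i (x * y) M.
Proof. by apply/matrixP => a b; rewrite !mxE; case: eqP => // _; rewrite mulrA. Qed.

Lemma scale_col1 r i (M : 'M_(r, N)) : scale_col i 1 M = M.
Proof. by apply/matrixP => a b; rewrite !mxE mul1r if_same. Qed.

Lemma add_colK r i j x : i != j ->
  involutive (@add_col r N i j x).
Proof.
move=> ij M; apply/matrixP => a b; rewrite !mxE (negPf ij).
by case: eqP => // _; rewrite -addrA addFF addr0.
Qed.

Lemma replace_col_swapK r i (M M' : 'M_(r, N)) :
  replace_col i (replace_col i M M') (replace_col i M' M) = M.
Proof. by apply/matrixP => a b; rewrite !mxE; case: eqP. Qed.

(* Between Hadamards, dividing Z by g(D) and multiplying X by g(1/D); here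
   g(D) = f(1/D) for f = D^l p, as p(1/D) = D^(1 - size p) (reverse_poly p). *)
Definition mul_word i l (p : {poly 'F_2}) (p0 : p != 0) : seq (op N) :=
  [:: Hadamard i;
      InfDepth i (- l - (size p).-1%:Z) (reverse_poly_neq0 p0); Hadamard i].

Lemma run_mul_word r i l p (p0 : p != 0) (Z X : 'M_(r, N)) :
  run (mul_word i l p0) (row_mx Z X) =
  row_mx (scale_col i (D ^ (- l) * at_Dinv p)^-1 Z)
         (scale_col i (D ^ l * toF2D p) X).
Proof.
rewrite /run /= !op_act_row_mx.
have sE : D ^ (- l - (size p).-1%:Z) * toF2D (reverse_poly p) =
    D ^ (- l) * at_Dinv p.
  by rewrite at_Dinv_reverse expfzDr ?D_neq0 // -exprnN mulrCA mulrC mulrA.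
have sE' : D ^ (- (- l - (size p).-1%:Z)) * at_Dinv (reverse_poly p) =
    D ^ l * toF2D p.
  (* This is the image of [sE] under the involution [flip]. *)
  apply: (can_inj flipK).
  rewrite !(rmorphM flip) /= !rmorphXz /= ?unitfE ?D_neq0 //.
  rewrite flip_at_Dinv flip_toF2D flipD.
  by rewrite !exprz_inv opprK sE.
rewrite sE sE'; congr row_mx; apply/matrixP => a b; rewrite !mxE;
  by case: eqP.
Qed.

(** A CNOT is its own inverse in characteristic 2; [mul_word] undoes the division performed by
    [InfDepth]. *)
Lemma op_inverse (o : op N) :
  exists w, forall r (M : pauli_mx r N), run w (op_act o M) = M.
Proof.
case: o => [i j k ij|i|i j|i l|i l p p0].
- exists [:: CNOT k ij] => r M; rewrite -[M]hsubmxK /run /= !op_act_row_mx.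
  by rewrite !add_colK // eq_sym.
- exists [:: Hadamard i] => r M; rewrite -[M]hsubmxK /run /= !op_act_row_mx.
  by rewrite !replace_col_swapK.
- exists [:: Swap i j] => r M; rewrite -[M]hsubmxK /run /= !op_act_row_mx.
  by rewrite /xcol -!col_permM perm.tperm2 !col_perm1.
- exists [:: Delay i (- l)] => r M; rewrite -[M]hsubmxK /run /= !op_act_row_mx.
  by rewrite !scale_colM -expfzDr ?D_neq0 // addNr expr0z !scale_col1.
- exists (mul_word i l p0) => r M.
  rewrite -[M]hsubmxK !op_act_row_mx run_mul_word !scale_colM.
  have a0 : D ^ (- l) * at_Dinv p != 0.
    by rewrite mulf_neq0 ?at_Dinv_eq0 ?(expfz_neq0 _ D_neq0).
  have b0 : D ^ l * toF2D p != 0.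
    by rewrite mulf_neq0 ?toF2D_eq0 ?(expfz_neq0 _ D_neq0).
  by rewrite (mulVf a0) (mulfV b0) !scale_col1 hsubmxK.
Qed.

Lemma run_inverse w :
  exists w', forall r (M : pauli_mx r N), run w' (run w M) = M.
Proof.
elim: w => [|o w [w' IH]]; first by exists [::].
have [v vP] := op_inverse o.
by exists (w' ++ v) => r M; rewrite run_cat IH vP.
Qed.

(* Preservation of the shifted symplectic product forces the action M' on Z. *)
Definition css_realizable (M : 'M[F2D]_N) : Prop :=
  exists w (M' : 'M[F2D]_N), M' *m (map_mx flip M)^T = 1%:M /\
    forall r (Z X : 'M_(r, N)), run w (row_mx Z X) = row_mx (Z *m M') (X *m M).

Lemma css_realizable1 : css_realizable 1%:M.
Proof.
exists [::], 1%:M; split=> [|r Z X]; last by rewrite !mulmx1.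
by rewrite map_mx1 trmx1 mulmx1.
Qed.

Lemma css_realizableM A B :
  css_realizable A -> css_realizable B -> css_realizable (A *m B).
Proof.
move=> [w [A' [dA wA]]] [v [B' [dB vB]]]; exists (w ++ v), (A' *m B').
split=> [|r Z X]; last by rewrite run_cat wA vB !mulmxA.
by rewrite map_mxM trmx_mul mulmxA -(mulmxA A') dB mulmx1.
Qed.

Lemma scale_colE r i x (M : 'M_(r, N)) :
  scale_col i x M = M *m (1%:M + (x - 1) *: delta_mx i i).
Proof.
apply/matrixP => a b; rewrite mulmxDr mulmx1 -scalemxAr mxE [RHS]mxE mxE.
rewrite (_ : (M *m _) a b = M a i * (b == i)%:R).
  by have [->|_] := eqVneq; rewrite /=; ring.
rewrite mxE (bigD1 i) //= big1 ?addr0 => [|j ji]; rewrite mxE ?eqxx //.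
by rewrite (negPf ji) mulr0.
Qed.

Lemma add_colE r i j x (M : 'M_(r, N)) :
  add_col i j x M = M *m (1%:M + x *: delta_mx i j).
Proof.
apply/matrixP => a b; rewrite mulmxDr mulmx1 -scalemxAr mxE [RHS]mxE [in RHS]mxE.
rewrite (_ : (M *m _) a b = M a i * (b == j)%:R).
  by have [->|_] := eqVneq; rewrite /=; ring.
rewrite mxE (bigD1 i) //= big1 ?addr0 => [|l li]; rewrite mxE ?eqxx //.
by rewrite (negPf li) mulr0.
Qed.

(** For x = p/q, [InfDepth] divides by q and [mul_word] multiplies by p. *)
Lemma css_realizable_scaling i x :
  x != 0 -> css_realizable (1%:M + (x - 1) *: delta_mx i i).
Proof.
have [p [q q0 ->]] := F2D_fraction x => pq0.
have p0 : p != 0 by apply: contraNneq pq0 => ->; rewrite rmorph0 mul0r.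
exists (InfDepth i 0 q0 :: mul_word i 0 p0).
exists (1%:M + ((flip (toF2D p / toF2D q))^-1 - 1) *: delta_mx i i).
split=> [|r Z X].
  rewrite map_mxD map_mx1 map_mxZ map_delta_mx.
  rewrite linearD /= trmx1 linearZ /= trmx_delta.
  set y := toF2D p / _ in pq0 *; have fy : flip y != 0 by rewrite fmorph_eq0.
  rewrite (rmorphB flip) (rmorph1 flip) -scale_colE.
  rewrite -[X in scale_col _ _ X]mul1mx -scale_colE.
  by rewrite scale_colM (mulfV fy) scale_col1.
rewrite -[run _ _]/(run (mul_word i 0 p0) (op_act _ _)) op_act_row_mx.
rewrite run_mul_word !scale_colM -!scale_colE oppr0 !expr0z !mul1r.
by rewrite flip_fraction // invf_div mulrC.
Qed.

Lemma css_realizable_CNOT i j :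
  i != j -> css_realizable (1%:M + delta_mx i j).
Proof.
move=> ij; exists [:: CNOT 0 ij], (1%:M + delta_mx j i).
split=> [|r Z X].
  rewrite map_mxD map_mx1 map_delta_mx linearD /= trmx1 trmx_delta.
  rewrite -[delta_mx j i]scale1r -add_colE -[X in add_col _ _ _ X]mul1mx.
  by rewrite -add_colE add_colK // eq_sym.
rewrite /run /= op_act_row_mx oppr0 !expr0z.
by rewrite !add_colE !scale1r.
Qed.

(** Conjugating an undelayed CNOT by a scaling of column j gives it an arbitrary nonzero
    coefficient. *)
Lemma css_realizable_transvection i j x :
  i != j -> css_realizable (1%:M + x *: delta_mx i j).
Proof.
move=> ij; have [->|x0] := eqVneq x 0.
  by rewrite scale0r addr0; apply: css_realizable1.
suff <- : (1%:M + (x^-1 - 1) *: delta_mx j j) *m (1%:M + delta_mx i j)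
          *m (1%:M + (x - 1) *: delta_mx j j) = 1%:M + x *: delta_mx i j.
  apply: css_realizableM (css_realizable_scaling _ x0).
  apply: css_realizableM (css_realizable_CNOT ij).
  by apply: css_realizable_scaling; rewrite invr_eq0.
rewrite -[_ + delta_mx i j]/(1%:M + delta_mx i j) -[delta_mx i j in LHS]scale1r.
rewrite -[X in X *m _ *m _]mul1mx -scale_colE -add_colE -scale_colE.
apply/matrixP => a b; rewrite !mxE (negPf ij).
rewrite [in RHS]mulr_natr.
have [->|nb] := eqVneq b j; rewrite ?andbT ?andbF ?mulr0n ?addr0 //.
by rewrite mul1r mulrDr mulrA divff // mul1r mulr_natr.
Qed.

Lemma unitmx_css_realizable A : A \in unitmx -> css_realizable A.
Proof.
apply: unitmx_elementary.
- exact: css_realizable1.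
- exact: css_realizableM.
- exact: css_realizable_transvection.
- exact: css_realizable_scaling.
Qed.

(** Two Hadamards on the same qubit would cancel, hence [uniq]. *)
Lemma run_Hadamards r (s : seq 'I_N) (Z X : 'M_(r, N)) : uniq s ->
  run [seq Hadamard i | i <- s] (row_mx Z X) =
  row_mx (\matrix_(a, b) (if b \in s then X a b else Z a b))
         (\matrix_(a, b) (if b \in s then Z a b else X a b)).
Proof.
elim: s Z X => [|i s IH] Z X /=.
  by move=> _; rewrite /run /=; congr row_mx; apply/matrixP => a b; rewrite mxE.
case/andP=> nis us; rewrite -[run _ _]/(run _ (op_act _ _)) op_act_row_mx IH //.
by congr row_mx; apply/matrixP => a b; rewrite !mxE in_cons;
  have [->|] := eqVneq; rewrite ?(negPf nis).
Qed.

End Operations.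

(** * Circuits on Alice's qubits *)

Section Alice.
Variables c n : nat.

Lemma rshift_neq (i j : 'I_n) : i != j -> rshift c i != rshift c j.
Proof. by rewrite eq_rshift. Qed.

Definition alice_op (o : op n) : op (c + n) :=
  match o with
  | CNOT i j k ij => CNOT k (rshift_neq ij)
  | Hadamard i => Hadamard (rshift c i)
  | Swap i j => Swap (rshift c i) (rshift c j)
  | Delay i l => Delay (rshift c i) l
  | InfDepth i l p p0 => InfDepth (rshift c i) l p0
  end.

Lemma on_alice_map w : on_alice (map alice_op w).
Proof.
elim: w => //= o w IH; rewrite -/(on_alice _) {}IH andbT.
by case: o => *; rewrite /= ?leq_addr.
Qed.

(** The lifted operation neither reads nor writes Bob's columns, so it commutes with the
    restriction. *)
Lemma alice_part_op r (o : op n) (M : pauli_mx r (c + n)) :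
  alice_part (op_act (alice_op o) M) = op_act o (alice_part M).
Proof.
rewrite -[M]hsubmxK /alice_part; case: o => [i j k ij|i|i j|i l|i l p p0];
  rewrite /alice_op !op_act_row_mx !row_mxKl !row_mxKr;
  congr row_mx; apply/matrixP => a b; rewrite !mxE ?eq_rshift //.
all: by case: perm.tpermP => [/rshift_inj->|/rshift_inj->|];
  rewrite ?perm.tpermL ?perm.tpermR // => /eqP + /eqP;
  rewrite !eq_rshift => bi bj; rewrite perm.tpermD // eq_sym.
Qed.

Lemma alice_part_run r w (M : pauli_mx r (c + n)) :
  alice_part (run (map alice_op w) M) = run w (alice_part M).
Proof. by elim: w M => //= o w IH M; rewrite -alice_part_op -IH. Qed.

End Alice.

(** * Row spaces and the adapted basis *)

(** If B = T A has full row rank, the square factor T is invertible; one inclusion of row spaces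
    thus suffices. *)
Lemma submx_row_equivalent r1 r2 m (A : 'M[F2D]_(r1, m)) (B : 'M[F2D]_(r2, m)) :
  r1 = r2 -> (B <= A)%MS -> row_free B -> row_equivalent A B.
Proof.
move=> e; subst r1 => /submxP[T BT] /eqP fB; exists erefl, (invmx T).
have uT : T \in unitmx.
  by rewrite -row_free_unit /row_free eqn_leq rank_leq_row -{1}fB BT mxrankM_maxl.
by rewrite unitmx_inv castmx_id BT mulKmx.
Qed.

(** Turns a condition on the support of [Y] into an inclusion of row spaces. *)
Lemma mulmx_sub_rows (F : fieldType) p q r m (Y : 'M[F]_(p, q))
    (E : 'M_(q, m)) (S : 'M_(r, m)) :
  (forall i j, Y i j != 0 -> (row j E <= S)%MS) -> (Y *m E <= S)%MS.
Proof.
move=> h; apply/row_subP => i; rewrite row_mul mulmx_sum_row.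
apply: summx_sub => j _; rewrite mxE; have [->|/h sE] := eqVneq (Y i j) 0.
  by rewrite scale0r sub0mx.
exact: scalemx_sub.
Qed.

Lemma row_base_of_rank (F : fieldType) p m r (A : 'M[F]_(p, m)) :
  \rank A = r -> exists B : 'M_(r, m), (B :=: A)%MS.
Proof. by move<-; exists (row_base A); apply: eq_row_base. Qed.

(** In the application [G] is the conjugate of H_1, [H] is H_2 and [K] the annihilator of [G]. The
    blocks of [M] are, in order, [C] for [H :\: K], [E] for a complement of H + K, [A] for [H :&: K]
    and [B] for [K :\: H]. [G] annihilates [A] and [B], while [C] and [A] span [H]. *)
Lemma adapted_basis (F : fieldType) (c a b k n r1 r2 : nat)
    (G : 'M[F]_(r1, n)) (H : 'M[F]_(r2, n)) :
  r1 = (c + a)%N -> r2 = (c + b)%N -> n = (c + a + (b + k))%N ->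
  row_free G -> row_free H -> \rank (H *m G^T) = c ->
  exists2 M : 'M_n, M \in unitmx &
    (forall i (j : 'I_n), (c + a <= j)%N -> (G *m M^T) i j = 0) /\
    exists2 Y : 'M_(r2, n), H = Y *m M &
      forall i (j : 'I_n), Y i j != 0 -> (j < c)%N || (c + a <= j < c + a + b)%N.
Proof.
move=> r1E r2E nE /eqP rG /eqP rH rHG; pose K := kermx G^T.
have rK : \rank K = (b + k)%N by rewrite mxrank_ker mxrank_tr; lia.
have rHK : \rank (H :&: K)%MS = b.
  by have := mxrank_mul_ker H G^T; rewrite -/K; lia.
have rHdK : \rank (H :\: K)%MS = c by have := mxrank_cap_compl H K; lia.
have rKdH : \rank (K :\: H)%MS = k.
  by have := mxrank_cap_compl K H; rewrite capmxC; lia.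
have rE : \rank (H + K)^C%MS = a.
  by have := mxrank_sum_cap H K; rewrite mxrank_compl; lia.
have [C CE] := row_base_of_rank rHdK; have [E EE] := row_base_of_rank rE.
have [A AE] := row_base_of_rank rHK; have [B BE] := row_base_of_rank rKdH.
have sH : (H <= col_mx C A)%MS.
  rewrite -addsmxE -(addsmx_diff_cap_eq H K).
  by apply: addsmxS; rewrite ?CE ?AE.
have sK : (K <= col_mx A B)%MS.
  rewrite -addsmxE -{1}(addsmx_diff_cap_eq K H) addsmxC capmxC.
  by apply: addsmxS; rewrite ?AE ?BE.
have GA : G *m A^T = 0.
  apply: trmx_inj; rewrite trmx_mul trmxK trmx0; apply/sub_kermxP.
  by rewrite AE capmxSr.
have GB : G *m B^T = 0.
  apply: trmx_inj; rewrite trmx_mul trmxK trmx0; apply/sub_kermxP.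
  by rewrite BE diffmxSl.
subst n; exists (col_mx (col_mx C E) (col_mx A B)).
  rewrite -row_full_unit -sub1mx.
  have : (1%:M <= H + K + (H + K)^C)%MS by rewrite sub1mx addsmx_compl_full.
  have sE : ((H + K)^C <= col_mx C E)%MS by rewrite -EE -addsmxE addsmxSr.
  have sC : (C <= col_mx C E)%MS by rewrite -addsmxE addsmxSl.
  have sA : (A <= col_mx A B)%MS by rewrite -addsmxE addsmxSl.
  move/submx_trans; apply; rewrite -(addsmxE (col_mx C E) (col_mx A B)) !addsmx_sub.
  rewrite (submx_trans sH) ?(submx_trans sK) ?(submx_trans sE);
    rewrite ?addsmxSl ?addsmxSr //.
  rewrite col_mx_sub (submx_trans sC) ?(submx_trans sA) ?addsmxSl ?addsmxSr //.
split=> [i j ltj|].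
  rewrite !tr_col_mx !mul_mx_row GA GB row_mx0.
  by case: (split_ordP j) ltj => l ->; rewrite ?row_mxEr ?mxE //= leqNgt ltn_ord.
have /submxP[Y0 HY] := sH.
(* The coordinates of [H] on the blocks [E] and [B] are zero. *)
exists (row_mx (row_mx (lsubmx Y0) 0) (row_mx (rsubmx Y0) 0)).
  by rewrite !mul_row_col !mul0mx !addr0 -mul_row_col hsubmxK.
move=> i j; case: (split_ordP j) => l ->; rewrite ?row_mxEl ?row_mxEr.
- case: (split_ordP l) => t ->; first by [].
  by rewrite row_mxEr mxE eqxx.
- case: (split_ordP l) => t ->; last by rewrite row_mxEr mxE eqxx.
  by have := ltn_ord t => /= *; lia.
Qed.

(** * Rows of the unencoded stabilizer seen by Alice *)

(** Without Bob's half, each ebit leaves a Z row and an X row on one qubit. The [c] ebit Z rows come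
    first, which shifts the index of every other row by [c]. *)
Lemma alice_stabilizer (n k c : nat) :
  alice_part (stabilizer_mx n k c) = row_mx
    (\matrix_(i, q)
        ((q == i :> nat) && (i < c) || (q + c == i) && (c + c <= i))%N%:R)
    (\matrix_(i, q) ((q + c == i) && (i < c + c))%N%:R).
Proof.
rewrite /alice_part /stabilizer_mx; congr row_mx; apply/matrixP => i q;
  rewrite [LHS]mxE [LHS]mxE [RHS]mxE; have ltqn := ltn_ord q;
  case: (split_ordP i) => {}i ->; rewrite ?col_mxEu ?col_mxEd.
- case: (split_ordP i) => {}i ->; rewrite ?block_mxEul ?block_mxEdl mxE;
    have lti := ltn_ord i; try rewrite -[0 in LHS]/(false%:R);
    congr (nat_of_bool _)%:R => /=; lia.
- rewrite row_mxEl mxE; congr (nat_of_bool _)%:R => /=; lia.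
- case: (split_ordP i) => {}i ->; rewrite ?block_mxEur ?block_mxEdr mxE;
    have lti := ltn_ord i; try rewrite -[0 in LHS]/(false%:R);
    congr (nat_of_bool _)%:R => /=; lia.
- rewrite row_mxEr mxE -[0 in LHS]/(false%:R).
  congr (nat_of_bool _)%:R => /=; lia.
Qed.

Section Rows.
Variables (n k c a b : nat).
Hypothesis nE : n = (c + a + (b + k))%N.

(** The last [b] of the [a + b] ancillas, which carry the basis of [H :&: K]. *)
Definition X_ancillas : seq 'I_n :=
  [seq q : 'I_n <- enum 'I_n | c + a <= q < c + a + b]%N.

Let S := run [seq Hadamard q | q <- X_ancillas] (alice_part (stabilizer_mx n k c)).

Lemma mem_X_ancillas (q : 'I_n) :
  (q \in X_ancillas) = (c + a <= q < c + a + b)%N.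
Proof. by rewrite mem_filter mem_enum andbT. Qed.

Let SE : S = row_mx
    (\matrix_(i, q) (if (c + a <= q < c + a + b)%N then (q + c == i) && (i < c + c)
        else (q == i :> nat) && (i < c) || (q + c == i) && (c + c <= i))%N%:R)
    (\matrix_(i, q) (if (c + a <= q < c + a + b)%N then
        (q == i :> nat) && (i < c) || (q + c == i) && (c + c <= i)
        else (q + c == i) && (i < c + c))%N%:R).
Proof.
have uJ : uniq X_ancillas by apply: filter_uniq; apply: enum_uniq.
rewrite /S alice_stabilizer run_Hadamards // {uJ}.
by congr row_mx; apply/matrixP => i q; rewrite !mxE mem_X_ancillas; case: ifP.
Qed.

Lemma Z_row_sub (q : 'I_n) : (q < c + a)%N ->
  (row_mx (delta_mx 0 q) (0 : 'rV_n) <= S)%MS.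
Proof.
(* The Z row of ebit q, or the row of the ancilla at q. *)
move=> qca; pose i := if (q < c)%N then q : nat else (q + c)%N.
have iP : (i < c + c + (n - k - c))%N by rewrite /i; case: ifP; lia.
apply: (eq_row_sub (Ordinal iP)); rewrite SE row_row_mx.
congr row_mx; apply/rowP => t; rewrite !mxE -?val_eqE /= -1?[0]/(false%:R);
  congr (nat_of_bool _)%:R; rewrite /i; case: (ltnP q c); case: ifP; lia.
Qed.

Lemma X_row_sub (q : 'I_n) : (q < c)%N || (c + a <= q < c + a + b)%N ->
  (row_mx (0 : 'rV_n) (delta_mx 0 q) <= S)%MS.
Proof.
(* Row [q + c] is the X row of an ebit, or an ancilla row turned from Z to X by a Hadamard. *)
move=> qJ; have iP : (q + c < c + c + (n - k - c))%N by lia.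
apply: (eq_row_sub (Ordinal iP)); rewrite SE row_row_mx.
congr row_mx; apply/rowP => t; rewrite !mxE -?val_eqE /= -1?[0]/(false%:R);
  congr (nat_of_bool _)%:R; case: ifP; lia.
Qed.
End Rows.

(** * Encoding, decoding and the parameters of the code *)

(** Z columns transform by the inverse conjugate transpose of [M], so it is the conjugate [G] of
    [F1] that is adapted to [M]. *)
Lemma encodes_css (n k c a b r1 r2 : nat) (F1 : 'M[F2D]_(r1, n)) (F2 : 'M_(r2, n)) :
  r1 = (c + a)%N -> r2 = (c + b)%N -> n = (c + a + (b + k))%N ->
  row_free F1 -> row_free F2 -> \rank (F1 *m (map_mx flip F2)^T) = c ->
  exists enc : seq (op (c + n)), encodes k enc (block_mx F1 0 0 F2).
Proof.
move=> r1E r2E nE f1 f2 rc; pose G := map_mx flip F1.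
have mapK p q (A : 'M_(p, q)) : map_mx flip (map_mx flip A) = A.
  by apply/matrixP => i j; rewrite !mxE flipK.
have fG : row_free G by rewrite /G row_free_map.
(* Up to transposition and conjugation, this is the product in the hypothesis. *)
have rG : \rank (F2 *m G^T) = c.
  by rewrite -mxrank_tr trmx_mul trmxK -(mxrank_map flip) map_mxM mapK -map_trmx.
have [M uM [GM [Y F2E YJ]]] := adapted_basis r1E r2E nE fG f2 rG.
have [w [M' [MM' wP]]] := unitmx_css_realizable uM.
pose S := run [seq Hadamard q | q <- X_ancillas n c a b]
              (alice_part (stabilizer_mx n k c)).
exists (map (@alice_op c n) ([seq Hadamard q | q <- X_ancillas n c a b] ++ w)).
split; first exact: on_alice_map.
rewrite alice_part_run run_cat -/S -[S]hsubmxK wP.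
have -> : row_mx (lsubmx S *m M') (rsubmx S *m M) = S *m block_mx M' 0 0 M.
  by rewrite -{3}[S]hsubmxK mul_row_block !mulmx0 addr0 add0r.
apply: submx_row_equivalent; first by lia.
  (* The coordinates of [F1] on the rows of [M'] are the conjugates of G M^T, so they vanish from
     column [c + a] on. *)
  have F1E : F1 = (map_mx flip (G *m M^T)) *m M'.
    by rewrite map_mxM mapK -map_trmx -mulmxA (mulmx1C MM') mulmx1.
  have -> : block_mx F1 0 0 F2 =
      block_mx (map_mx flip (G *m M^T)) 0 0 Y *m block_mx M' 0 0 M.
    by rewrite mulmx_block !mul0mx !mulmx0 !addr0 add0r -F1E -F2E.
  apply: submxMr; rewrite /block_mx col_mx_sub; apply/andP; split.
    rewrite (_ : row_mx _ 0 = map_mx flip (G *m M^T) *m row_mx 1%:M 0); last first.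
      by rewrite mul_mx_row mulmx1 mulmx0.
    apply: mulmx_sub_rows => i j; rewrite mxE row_row_mx row1 row0 => h.
    apply: (Z_row_sub nE); rewrite ltnNge; apply: contra h => ltj.
    by rewrite GM // rmorph0.
  rewrite (_ : row_mx 0 Y = Y *m row_mx 0 1%:M); last first.
    by rewrite mul_mx_row mulmx1 mulmx0.
  apply: mulmx_sub_rows => i j; rewrite row_row_mx row1 row0 => h.
  exact: (X_row_sub nE (YJ i j h)).
by rewrite /row_free rank_diag_block_mx (eqP f1) (eqP f2).
Qed.

(** The inverse circuit restores [info_mx] exactly, with zero delays and no stabilizer
    correction. *)
Lemma decodes_run_inverse (n k c : nat) (enc : seq (op (c + n))) :
  (k <= n)%N -> exists dec, decodes k enc dec.
Proof.
move=> kn; have [dec decK] := run_inverse enc; exists dec.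
have sP (i : 'I_k) : (c + (n - k) + i < c + n)%N by have := ltn_ord i; lia.
exists (fun i => Ordinal (sP i)), (fun=> 0), 0; split.
  by move=> i j [] /addnI /val_inj.
rewrite mul0mx addr0 decK; congr block_mx; apply/matrixP => i j;
  by rewrite !mxE expr0z -val_eqE /=; case: eqP.
Qed.

(** Matrices invertible over F_2[D] stay invertible over F_2(D), so the rank is that of [I 0]. *)
Lemma noncatastrophic_rank (m n : nat) (H : 'M[{poly 'F_2}]_(m, n)) :
  (m <= n)%N -> noncatastrophic_delay_free H -> row_free (map_mx toF2D H).
Proof.
move=> mn [A [B [uA uB ->]]]; rewrite !map_mxM map_pid_mx.
have map_unit p (U : 'M_p) : U \in unitmx -> map_mx toF2D U \in unitmx.
  by move=> uU; rewrite unitmxE det_map_mx rmorph_unit -?unitmxE.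
rewrite /row_free mxrankMfree ?row_free_unit ?map_unit // -mxrank_tr trmx_mul.
by rewrite mxrankMfree ?row_free_unit ?unitmx_tr ?map_unit // mxrank_tr rank_pid_mx.
Qed.

Theorem theorem1 (n k1 k2 c : nat) (C1 C2 : {vspace 'rV[F2D]_n})
    (H1 : 'M[{poly 'F_2}]_(n - k1, n)) (H2 : 'M[{poly 'F_2}]_(n - k2, n))
    (hC1 : convolutional_code k1 C1) (hC2 : convolutional_code k2 C2)
    (hH1 : check_matrix C1 H1) (hH2 : check_matrix C2 H2)
    (hN1 : noncatastrophic_delay_free H1) (hN2 : noncatastrophic_delay_free H2)
    (hc : c = \rank (map_mx toF2D H1 *m (map_mx at_Dinv H2)^T)) :
  (n <= k1 + k2 + c)%N /\
  EAQCC (k1 + k2 + c - n) c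
    (block_mx (map_mx toF2D H1) 0 0 (map_mx toF2D H2)).
Proof.
have dimC k (C : {vspace 'rV[F2D]_n}) : convolutional_code k C -> (k <= n)%N.
  by move<-; have := dimvS (subvf C); rewrite dimvf /dim /= mul1n.
have [k1n k2n] := (dimC _ _ hC1, dimC _ _ hC2).
have f1 := noncatastrophic_rank (leq_subr k1 n) hN1.
have f2 := noncatastrophic_rank (leq_subr k2 n) hN2.
have flipH2 : map_mx at_Dinv H2 = map_mx flip (map_mx toF2D H2).
  by apply/matrixP => i j; rewrite !mxE flip_toF2D.
rewrite flipH2 in hc; set F2 := map_mx toF2D H2 in f2 hc *.
have rF2 : \rank (map_mx flip F2)^T = (n - k2)%N.
  by rewrite mxrank_tr mxrank_map (eqP f2).
(* Sylvester's rank inequality gives n <= k1 + k2 + c, and the two upper bounds give c <= n - k1 and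
   c <= n - k2; all truncated subtractions are thus exact. *)
have rge := mxrank_mul_min (map_mx toF2D H1) (map_mx flip F2)^T.
have rle1 := mxrankM_maxl (map_mx toF2D H1) (map_mx flip F2)^T.
have rle2 := mxrankM_maxr (map_mx toF2D H1) (map_mx flip F2)^T.
rewrite -hc ?rF2 ?(eqP f1) in rge rle1 rle2.
have nc : (n <= k1 + k2 + c)%N by lia.
split=> //; split; first by lia.
have [||| enc encP] := @encodes_css n (k1 + k2 + c - n) c (n - k1 - c) (n - k2 - c)
    _ _ (map_mx toF2D H1) F2 _ _ _ f1 f2 (esym hc); try lia.
have [dec decP] := @decodes_run_inverse n (k1 + k2 + c - n) c enc ltac:(lia).
by exists enc, dec.
Qed.
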